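(* Let $\mathfrak g$ be an $8$-dimensional nilpotent real Lie algebra with $2$-dimensional center endowed with an abelian balanced Hermitian structure $(J,F)$, and let $\{e_1,\dots,e_8\}$ be an adapted basis of $\mathfrak g$ for which the structure equations are of the form $$de^i=0\ (i=1,2,3,4),\qquad de^i=c_{12}^i\beta_1+c_{13}^i\gamma_{13}+c_{14}^i\gamma_{14}\ (i=5,6),$$ $$de^i=c_{12}^i\beta_1+(c_{12}^i+c_{34}^i)\beta_2+c_{13}^i\gamma_{13}+c_{14}^i\gamma_{14}+c_{15}^i\gamma_{15}+c_{16}^i\gamma_{16}+c_{35}^i\gamma_{25}+c_{36}^i\gamma_{26}\ (i=7,8),$$ with real coefficients $c_{jk}^i$. Then $\mathfrak g$ satisfies one of the following conditions: \begin{enumerate} \item[II.1)] $de^5=de^6=0$ and $\mathfrak g$ is $2$-step nilpotent; \item[II.2)] $de^5$ and $de^6$ are linearly independent and $\mathfrak g$ is $3$-step nilpotent. \end{enumerate}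
   Context: $d$ is the Chevalley-Eilenberg differential: $d\alpha(X,Y)=-\alpha([X,Y])$ for $\alpha\in\mathfrak g^*$; $e^{ij}=e^i\wedge e^j$. A complex structure on a real Lie algebra $\mathfrak g$ is a linear map $J$ with $J^2=-\mathrm{Id}$ and $[JX,JY]-J[JX,Y]-J[X,JY]-[X,Y]=0$; it is abelian if $[JX,JY]=[X,Y]$ for all $X,Y$. A Hermitian structure on $\mathfrak g$, $\dim\mathfrak g=2n$, is a pair $(J,g)$ with $J$ a complex structure and $g$ an inner product with $g(JX,JY)=g(X,Y)$, equivalently denoted $(J,F)$ with $F(X,Y)=g(X,JY)$; it is balanced if $d(F^{n-1})=0$ (here $n=4$). $(J,F)$ is abelian balanced if $J$ is abelian and $F$ is balanced. An adapted basis is a $g$-orthonormal basis with $Je_{2k-1}=-e_{2k}$, so that $F=\sum_k e^{2k-1,2k}$; $\{e^i\}$ is the dual basis. The $2$-forms are $\beta_1=e^{12}-e^{34}$, $\beta_2=e^{34}-e^{56}$, $\gamma_{13}=e^{13}+e^{24}$, $\gamma_{14}=e^{14}-e^{23}$, $\gamma_{15}=e^{15}+e^{26}$, $\gamma_{16}=e^{16}-e^{25}$, $\gamma_{25}=e^{35}+e^{46}$, $\gamma_{26}=e^{36}-e^{45}$. An adapted basis with structure equations of the displayed form exists for every abelian balanced Hermitian structure on an $8$-dimensional nilpotent Lie algebra. *)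

(* Defs.v *)
From HB Require Import structures.
From mathcomp Require Import all_boot all_order all_algebra all_fingroup.
From mathcomp Require Import sesquilinear.
From mathcomp Require Import boolp functions reals.
Set Implicit Arguments.
Unset Strict Implicit.
Unset Printing Implicit Defensive.

Import Order.TTheory GRing.Theory Num.Theory.
Local Open Scope ring_scope.

HB.mixin Record isLieAlgebra (R : fieldType) g of Vector R g := {
  lie : {bilinear g -> g -> g | *:%R & *:%R};
  lie_alternating : forall x, lie x x = 0;
  lie_jacobi : forall x y z,
    lie x (lie y z) + lie y (lie z x) + lie z (lie x y) = 0
}.

#[short(type="lieAlgType")]
HB.structure Definition LieAlgebra (R : fieldType) :=
  {g of Vector R g & isLieAlgebra R g}.

Section Nilpotency.
Variables (R : fieldType) (g : lieAlgType R).

Definition center : {vspace g} :=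
  lker (linfun (fun x : g => linfun (lie x : g -> g))).

Lemma centerP (x : g) : reflect (forall y : g, lie x y = 0) (x \in center).
Proof.
have add_lin : zmod_morphism (fun x : g => linfun (lie x : g -> g)).
  move=> a b; apply/lfunP => y.
  by rewrite add_lfunE opp_lfunE !lfunE /= linearBl.
have sca_lin : scalable (fun x : g => linfun (lie x : g -> g)).
  move=> k a; apply/lfunP => y.
  by rewrite lfunE /= scale_lfunE !lfunE /= linearZl_LR.
pose f1 := GRing.isZmodMorphism.Build g _ _ add_lin.
pose f2 := GRing.isScalable.Build R g _ _ _ sca_lin.
pose f : {linear g -> 'End(g)} :=
  HB.pack (fun x : g => linfun (lie x : g -> g)) f1 f2.
rewrite memv_ker -[fun x0 : g => _]/(f : g -> 'End(g)) lfunE /=.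
apply: (iffP eqP) => [x0 y|x0].
  by have /lfunP/(_ y) := x0; rewrite lfunE zero_lfunE.
by apply/lfunP => y; rewrite lfunE zero_lfunE; exact: x0.
Qed.

Definition lie_prodv (U V : {vspace g}) : {vspace g} :=
  <<[seq lie x y | x <- vbasis U, y <- vbasis V]>>%VS.

Lemma memv_lie (U V : {vspace g}) (x y : g) :
  x \in U -> y \in V -> lie x y \in lie_prodv U V.
Proof.
move=> /coord_vbasis-> /coord_vbasis->.
rewrite linear_sumlz memv_suml // => i _.
rewrite linear_sumr memv_suml // => j _.
rewrite linearZl_LR linearZr_LR /= !memvZ // memv_span //.
apply/allpairsP; exists ((vbasis U)`_i, (vbasis V)`_j).
by rewrite !mem_nth ?size_tuple.
Qed.

Fixpoint lower_central (k : nat) : {vspace g} :=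
  if k is k'.+1 then lie_prodv (lower_central k') fullv else fullv.

Definition nilpotent : Prop := exists s, lower_central s = 0%VS.

Definition step_nilpotent (s : nat) : Prop :=
  lower_central s = 0%VS /\ forall k, (k < s)%N -> lower_central k <> 0%VS.

End Nilpotency.

(* A k-form is used through its values on k-tuples of vectors; the operations
   below are the usual formulas on alternating multilinear maps. The codomain
   is R^o so that forms make up an lmodType under pointwise operations. *)
Definition form (R : realType) (g : lieAlgType R) (k : nat) : Type :=
  {ffun 'I_k -> g} -> R^o.

Section Forms.
Variables (R : realType) (g : lieAlgType R).

Definition wedge p q (a : form g p) (b : form g q) : form g (p + q)%N := fun v =>
  (p`! * q`!)%N%:R^-1 * \sum_(s : 'S_(p + q)%N)
    (-1) ^+ s * a [ffun i => v (s (lshift q i))]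
              * b [ffun j => v (s (rshift p j))].

Fixpoint wedge_pow (p : nat) (a : form g p) (k : nat) : form g (k * p)%N :=
  if k is k'.+1 then wedge a (@wedge_pow p a k') else fun _ => 1.
Arguments wedge_pow {p} a k.

(* (d a)(v_0, ..., v_k) is the sum over i < j of
   (-1)^(i+j) a([v_i, v_j], v_0, ..., v_k) with v_i and v_j omitted at the end. *)
Definition ce_diff k (a : form g k) : form g k.+1 := fun v =>
  \sum_(i < k.+1) \sum_(j < k.+1 | (i < j)%N) (-1) ^+ (i + j)
    * a [ffun l : 'I_k => nth 0 (lie (v i) (v j) ::
                     [seq v m | m <- enum 'I_k.+1 & (m != i) && (m != j)]) l].

Lemma ce_diff1E (a : form g 1) v :
  ce_diff a v = - a [ffun=> lie (v ord0) (v ord_max)].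
Proof.
rewrite /ce_diff big_ord_recl big_ord1 [X in _ + X]big_pred0 ?addr0; last first.
  by move=> j; case: j => [[|[|j]] ?].
rewrite (big_pred1 ord_max) => [|j]; last by case: j => [[|[|j]] ?].
rewrite expr1 mulN1r; congr (- a _).
by apply/ffunP => l; rewrite !ffunE (ord1 l).
Qed.

Lemma wedge11E (a b : form g 1) v :
  wedge a b v = a [ffun=> v ord0] * b [ffun=> v ord_max]
              - a [ffun=> v ord_max] * b [ffun=> v ord0].
Proof.
rewrite /wedge invr1 mul1r.
have S2 (s : 'S_2) : s = 1%g \/ s = tperm ord0 ord_max.
  have E (x : 'I_2) : x = ord0 \/ x = ord_max.
    by case: x => [[|[|x]] h] //; [left|right]; apply: val_inj.
  have ne : s ord0 != s ord_max by rewrite (inj_eq perm_inj).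
  case: (E (s ord0)) (E (s ord_max)) ne => s0 [] s1; rewrite s0 s1 // => _;
    [left|right]; apply/permP => x; case: (E x) => ->;
    by rewrite ?perm1 ?tpermL ?tpermR.
have n1 : tperm ord0 ord_max != 1%g :> 'S_2.
  by apply/eqP => /permP/(_ ord0); rewrite perm1 tpermL.
rewrite (bigD1 1%g) //= (bigD1 (tperm ord0 ord_max)) //= big1 => [|s]; last first.
  by case: (S2 s) => ->; rewrite eqxx ?andbF.
rewrite addr0 odd_perm1 odd_tperm /= expr0 expr1 !mul1r mulN1r mulNr.
have l0 (i : 'I_1) : lshift 1 i = ord0 by apply: val_inj; rewrite (ord1 i).
have r1 (i : 'I_1) : rshift 1 i = ord_max by apply: val_inj; rewrite (ord1 i).
by congr (a _ * b _ - a _ * b _); apply/ffunP => i;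
   rewrite !ffunE ?l0 ?r1 ?perm1 ?tpermL ?tpermR.
Qed.

Definition fundamental_form (J : 'End(g)) (h : {dot g for idfun}) : form g 2 :=
  fun v => h (v ord0) (J (v ord_max)).

Definition complex_structure (J : 'End(g)) : Prop :=
  (forall X, J (J X) = - X) /\
  (forall X Y, lie (J X) (J Y) - J (lie (J X) Y) - J (lie X (J Y)) - lie X Y = 0).

Definition abelian_complex (J : 'End(g)) : Prop :=
  forall X Y, lie (J X) (J Y) = lie X Y.

Definition hermitian_structure (J : 'End(g)) (h : {dot g for idfun}) : Prop :=
  complex_structure J /\ forall X Y, h (J X) (J Y) = h X Y.

Definition balanced (F : form g 2) : Prop :=
  ce_diff (wedge_pow F (\dim {:g})./2.-1) = 0.

Definition abelian_balanced (J : 'End(g)) (h : {dot g for idfun}) : Prop :=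
  [/\ hermitian_structure J h, abelian_complex J &
      balanced (fundamental_form J h)].

(* The list e is e_1, ..., e_n, so that e_(2k-1) = e`_(2(k-1)). *)
Definition adapted_basis n (J : 'End(g)) (h : {dot g for idfun})
    (e : n.-tuple g) : Prop :=
  [/\ basis_of fullv e,
      forall i j : 'I_n, h e`_i e`_j = (i == j)%:R &
      forall k, (k < n./2)%N -> J e`_(k.*2) = - e`_(k.*2.+1)].

End Forms.
Arguments wedge_pow {R g p} a k.

Section Coframe.
Variables (R : realType) (g : lieAlgType R) (e : 8.-tuple g).

(* e^i for i = 1, ..., 8 *)
Definition coframe (i : nat) : form g 1 :=
  fun v => coord e (inord i.-1) (v ord0).

Definition coframe2 (i j : nat) : form g 2 := wedge (coframe i) (coframe j).

Definition beta1 := coframe2 1 2 - coframe2 3 4.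
Definition beta2 := coframe2 3 4 - coframe2 5 6.
Definition gamma13 := coframe2 1 3 + coframe2 2 4.
Definition gamma14 := coframe2 1 4 - coframe2 2 3.
Definition gamma15 := coframe2 1 5 + coframe2 2 6.
Definition gamma16 := coframe2 1 6 - coframe2 2 5.
Definition gamma25 := coframe2 3 5 + coframe2 4 6.
Definition gamma26 := coframe2 3 6 - coframe2 4 5.

End Coframe.

Definition lin_indep2 (R : realType) (V : lmodType R) (x y : V) : Prop :=
  forall a b : R, a *: x + b *: y = 0 -> a = 0 /\ b = 0.

(* Main.v *)
Require Import Defs.
From HB Require Import structures.
From mathcomp Require Import all_boot all_order all_algebra.
From mathcomp Require Import sesquilinear.
From mathcomp Require Import boolp functions reals.
From mathcomp Require Import ring.

(** The structure equations say that the flag F4 = <e_5, ..., e_8>,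
    F6 = <e_7, e_8> satisfies [g, g] <= F4, [F4, g] <= F6 and [F6, g] = 0: each
    de^i with i <= 4 vanishes, de^5 and de^6 involve e^1, ..., e^4 only, and de^7
    and de^8 involve e^1, ..., e^6 only (lie_flag4, lie_flag6,
    flag6_sub_center). So g is at most 3-step nilpotent, and as the center has
    dimension 2 it equals F6. Hence [g, g] is central exactly when
    de^5 = de^6 = 0 (lower_central2_eq0P), which decides between 2-step and
    3-step; g is not abelian, for its center is not g.

    It remains to exclude that de^5 and de^6 are dependent and not both zero
    (dependent_ce_diff_eq0). If a de^5 + b de^6 = 0 with n = a^2 + b^2 != 0, put
    u = a e_6 - b e_5 and C = a de^6 - b de^5; modulo the center,
    n [X, Y] = - C(X, Y) u, so the Jacobi identity becomes

      C(X, Y) [Z, u] + C(Y, Z) [X, u] + C(Z, X) [Y, u] = 0,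

    that is, C /\ [-, u] = 0. Now beta_1, gamma_13 and gamma_14 span the
    anti-self-dual forms on <e_1, ..., e_4>, where a nonzero form is
    nondegenerate because its square is a nonzero multiple of the volume form;
    in dimension four, wedging 1-forms with it is injective
    (asd_wedge_inj). So C != 0 would make u a central vector outside F6; and
    C = 0 gives de^5 = de^6 = 0. *)

Set Implicit Arguments.
Unset Strict Implicit.
Unset Printing Implicit Defensive.
Import Order.TTheory GRing.Theory Num.Theory.
Local Open Scope ring_scope.

(** * The lower central series *)

Section LowerCentralSeries.
Variables (R : fieldType) (g : lieAlgType R).
Implicit Types (U V W : {vspace g}) (x y z : g).

Lemma lie_anticomm x y : lie x y = - lie y x.
Proof.
apply/eqP; rewrite -addr_eq0; apply/eqP.
have := lie_alternating (x + y).
by rewrite linearDl !linearDr /= !lie_alternating add0r addr0.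
Qed.

Lemma lie_prodv_sub U V W :
  (forall x y, x \in U -> y \in V -> lie x y \in W) -> (lie_prodv U V <= W)%VS.
Proof.
move=> UVW; apply/span_subvP => z /allpairsP[[x y] /= [xU yV ->]].
by apply: UVW; apply: vbasis_mem.
Qed.

Lemma lower_central1_sub W :
  (forall x y, lie x y \in W) -> (lower_central g 1 <= W)%VS.
Proof. by move=> lieW; apply: lie_prodv_sub. Qed.

Lemma lower_centralS_eq0 k :
  (lower_central g k <= center g)%VS -> lower_central g k.+1 = 0%VS.
Proof.
move=> /subvP kZ; apply/eqP; rewrite -subv0; apply: lie_prodv_sub => x y xk _.
by rewrite (centerP _ (kZ _ xk)) mem0v.
Qed.

(** Once a term of the series vanishes all later ones do, so the last nonzero
    term alone determines the step. *)
Lemma step_nilpotentS k :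
  lower_central g k.+1 = 0%VS -> lower_central g k <> 0%VS ->
  step_nilpotent g k.+1.
Proof.
move=> k0 kN0; split=> // m; rewrite ltnS => mk m0; apply: kN0.
rewrite -(subnK mk); elim: (k - m)%N => //= i ->.
apply/eqP; rewrite -subv0; apply: lie_prodv_sub => x y.
by rewrite memv0 => /eqP-> _; rewrite linear0l mem0v.
Qed.

End LowerCentralSeries.

(** * Coordinates and values of forms *)

Section Coordinates.
Variables (R : realType) (g : lieAlgType R) (e : 8.-tuple g).

Definition ffun_pair (X Y : g) : {ffun 'I_2 -> g} :=
  [ffun i => if i == ord0 then X else Y].

(** The covector e^i as a function on vectors, indexed from 1 as in coframe. *)
Definition xi (i : nat) (X : g) : R := coord e (inord i.-1) X.

Lemma xi_is_linear i : linear_for *%R (xi i).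
Proof. by move=> a X Y; rewrite /xi linearP. Qed.
HB.instance Definition _ i :=
  GRing.isLinear.Build R g R *%R (xi i) (xi_is_linear i).

Lemma ce_diff_coframeE i X Y :
  ce_diff (coframe e i) (ffun_pair X Y) = - xi i (lie X Y) :> R.
Proof. by rewrite ce_diff1E /coframe !ffunE. Qed.

Lemma coframe2E i j X Y :
  coframe2 e i j (ffun_pair X Y) = xi i X * xi j Y - xi i Y * xi j X :> R.
Proof. by rewrite /coframe2 wedge11E /coframe !ffunE. Qed.

(** Every argument of a 2-form is a pair of vectors, so testing on pairs
    suffices. *)
Lemma form2P (a b : Defs.form g 2) :
  (forall X Y, a (ffun_pair X Y) = b (ffun_pair X Y)) -> a = b.
Proof.
move=> ab; apply/funext => v; suff -> : v = ffun_pair (v ord0) (v ord_max) by [].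
apply/ffunP => i; rewrite ffunE; case: eqP => [-> //|i0]; congr (v _).
by case: i i0 => [[|[|i]] lti] i0 //; [case: i0|]; apply: val_inj.
Qed.

Hypothesis be : basis_of fullv e.

Lemma xi_basis i j : (0 < i <= 8)%N -> (j < 8)%N -> xi i e`_j = (i == j.+1)%:R.
Proof.
case: i => // i /= i8 j8; rewrite /xi.
rewrite -[j]/(nat_of_ord (Ordinal j8)) coord_free ?(basis_free be) //.
by rewrite -val_eqE /= inordK // eq_sym.
Qed.

Lemma xi_sum X : X = \sum_(i < 8) xi i.+1 X *: e`_i.
Proof.
rewrite [LHS](coord_basis be (memvf X)); apply: eq_bigr => i _.
by rewrite /xi /= inord_val.
Qed.

Lemma xi_eq0 X : (forall i, (0 < i <= 8)%N -> xi i X = 0) -> X = 0.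
Proof.
by move=> X0; rewrite [X]xi_sum big1 // => i _; rewrite X0 ?scale0r //= ltn_ord.
Qed.

(** The flag attached to the basis is <<drop k e>> = <e_(k+1), ..., e_8>;
    describing it by vanishing coordinates lets the structure equations, which
    bear on coordinates, act on it. *)
Lemma mem_flagP k X :
  reflect (forall i, (0 < i <= k)%N -> (i <= 8)%N -> xi i X = 0)
          (X \in <<drop k e>>%VS).
Proof.
apply: (iffP idP) => [Xk i /andP[i0 ik] i8|X0].
  rewrite (coord_span Xk) linear_sum big1 // => j _.
  have jk : (k + j < 8)%N by rewrite -ltn_subRL.
  rewrite linearZ /= nth_drop xi_basis ?i0 //.
  by rewrite ltn_eqF ?mulr0 // ltnS (leq_trans ik) ?leq_addr.
rewrite [X](xi_sum) memv_suml // => i _.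
have [ik|ki] := ltnP i k; first by rewrite X0 ?scale0r ?mem0v //= ltn_ord.
rewrite memvZ // memv_span //.
rewrite -(subnKC ki) -nth_drop mem_nth // size_drop size_tuple.
by rewrite ltn_sub2r // (leq_ltn_trans ki).
Qed.

Lemma dim_flag k : \dim <<drop k e>>%VS = (8 - k)%N.
Proof.
have /catr_free/eqP-> : free (take k e ++ drop k e).
  by rewrite cat_take_drop (basis_free be).
by rewrite size_drop size_tuple.
Qed.

End Coordinates.

(** * Anti-self-dual forms *)

Section AntiSelfDual.
Variables (R : realType) (g : lieAlgType R) (e : 8.-tuple g).
Variables (k1 k2 k3 : R).

(** The general anti-self-dual form on <e_1, ..., e_4>, for the metric in which
    these vectors are orthonormal and the orientation e^1234. *)
Definition asd : Defs.form g 2 :=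
  k1 *: beta1 e + k2 *: gamma13 e + k3 *: gamma14 e.

Lemma asdE X Y : asd (ffun_pair X Y) =
    k1 * ((xi e 1 X * xi e 2 Y - xi e 1 Y * xi e 2 X)
          - (xi e 3 X * xi e 4 Y - xi e 3 Y * xi e 4 X))
  + k2 * ((xi e 1 X * xi e 3 Y - xi e 1 Y * xi e 3 X)
          + (xi e 2 X * xi e 4 Y - xi e 2 Y * xi e 4 X))
  + k3 * ((xi e 1 X * xi e 4 Y - xi e 1 Y * xi e 4 X)
          - (xi e 2 X * xi e 3 Y - xi e 2 Y * xi e 3 X)) :> R.
Proof. by rewrite -!coframe2E. Qed.

Hypothesis be : basis_of fullv e.

(** Anti-self-dual forms square to -2 (k1^2 + k2^2 + k3^2) e^1234, so a nonzero one
    is nondegenerate on <e_1, ..., e_4>. The equations asd /\ f = 0 on the four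
    triples of basis vectors form a linear system in f(e_1), ..., f(e_4) whose
    matrix M satisfies M^T M = (k1^2 + k2^2 + k3^2) Id. Once these four values
    vanish, the triples (e_1, e_j, X) give k f(X) = 0 for each coefficient k and
    every X. *)
Lemma asd_wedge_inj (f : g -> R) :
  ~ (k1 = 0 /\ k2 = 0 /\ k3 = 0) ->
  (forall X Y Z, asd (ffun_pair X Y) * f Z + asd (ffun_pair Y Z) * f X
                 + asd (ffun_pair Z X) * f Y = 0) ->
  forall X, f X = 0.
Proof.
move=> kN0 Cf.
have N0 : k1 ^+ 2 + k2 ^+ 2 + k3 ^+ 2 != 0.
  apply/eqP => /eqP; rewrite !paddr_eq0 ?addr_ge0 ?sqr_ge0 // !sqrf_eq0.
  by move=> /andP[/andP[/eqP ? /eqP ?] /eqP ?]; apply: kN0.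
have E123 : k1 * f e`_2 - k3 * f e`_0 - k2 * f e`_1 = 0.
  by have := Cf e`_0 e`_1 e`_2; rewrite !asdE !xi_basis //= => <-; ring.
have E124 : k1 * f e`_3 + k2 * f e`_0 - k3 * f e`_1 = 0.
  by have := Cf e`_0 e`_1 e`_3; rewrite !asdE !xi_basis //= => <-; ring.
have E134 : k2 * f e`_3 - k1 * f e`_0 - k3 * f e`_2 = 0.
  by have := Cf e`_0 e`_2 e`_3; rewrite !asdE !xi_basis //= => <-; ring.
have E234 : - k3 * f e`_3 - k1 * f e`_1 - k2 * f e`_2 = 0.
  by have := Cf e`_1 e`_2 e`_3; rewrite !asdE !xi_basis //= => <-; ring.
(* Multiplication by the transpose of the matrix of the system isolates each
   value. *)
have f1 : f e`_0 = 0.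
  apply: (mulfI N0); rewrite mulr0.
  transitivity (- k3 * (k1 * f e`_2 - k3 * f e`_0 - k2 * f e`_1)
                + k2 * (k1 * f e`_3 + k2 * f e`_0 - k3 * f e`_1)
                - k1 * (k2 * f e`_3 - k1 * f e`_0 - k3 * f e`_2)); first ring.
  by rewrite E123 E124 E134; ring.
have f2 : f e`_1 = 0.
  apply: (mulfI N0); rewrite mulr0.
  transitivity (- k2 * (k1 * f e`_2 - k3 * f e`_0 - k2 * f e`_1)
                - k3 * (k1 * f e`_3 + k2 * f e`_0 - k3 * f e`_1)
                - k1 * (- k3 * f e`_3 - k1 * f e`_1 - k2 * f e`_2)); first ring.
  by rewrite E123 E124 E234; ring.
have f3 : f e`_2 = 0.
  apply: (mulfI N0); rewrite mulr0.
  transitivity (k1 * (k1 * f e`_2 - k3 * f e`_0 - k2 * f e`_1)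
                - k3 * (k2 * f e`_3 - k1 * f e`_0 - k3 * f e`_2)
                - k2 * (- k3 * f e`_3 - k1 * f e`_1 - k2 * f e`_2)); first ring.
  by rewrite E123 E134 E234; ring.
have f4 : f e`_3 = 0.
  apply: (mulfI N0); rewrite mulr0.
  transitivity (k1 * (k1 * f e`_3 + k2 * f e`_0 - k3 * f e`_1)
                + k2 * (k2 * f e`_3 - k1 * f e`_0 - k3 * f e`_2)
                - k3 * (- k3 * f e`_3 - k1 * f e`_1 - k2 * f e`_2)); first ring.
  by rewrite E124 E134 E234; ring.
move=> X; apply: (mulfI N0); rewrite mulr0.
have K1 : k1 * f X = 0.
  have := Cf e`_0 e`_1 X; rewrite f1 f2 asdE !xi_basis //= => <-; ring.
have K2 : k2 * f X = 0.
  have := Cf e`_0 e`_2 X; rewrite f1 f3 asdE !xi_basis //= => <-; ring.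
have K3 : k3 * f X = 0.
  have := Cf e`_0 e`_3 X; rewrite f1 f4 asdE !xi_basis //= => <-; ring.
transitivity (k1 * (k1 * f X) + k2 * (k2 * f X) + k3 * (k3 * f X)); first ring.
by rewrite K1 K2 K3; ring.
Qed.

End AntiSelfDual.

(** * Consequences of the structure equations *)

Section StructureEquations.
Variables (R : realType) (g : lieAlgType R) (e : 8.-tuple g).
Variables (c12 c13 c14 c34 c15 c16 c35 c36 : nat -> R).
Hypothesis be : basis_of fullv e.
Hypothesis dimZ : \dim (center g) = 2%N.
Hypothesis d1234 : forall i, i \in [:: 1; 2; 3; 4]%N -> ce_diff (coframe e i) = 0.
Hypothesis d56 : forall i, i \in [:: 5; 6]%N ->
  ce_diff (coframe e i) = asd e (c12 i) (c13 i) (c14 i).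
Hypothesis d78 : forall i, i \in [:: 7; 8]%N ->
  ce_diff (coframe e i) =
    c12 i *: beta1 e + (c12 i + c34 i) *: beta2 e
    + c13 i *: gamma13 e + c14 i *: gamma14 e
    + c15 i *: gamma15 e + c16 i *: gamma16 e
    + c35 i *: gamma25 e + c36 i *: gamma26 e.

Lemma xi_lieE i X Y :
  xi e i (lie X Y) = - (ce_diff (coframe e i) (ffun_pair X Y) : R).
Proof. by rewrite ce_diff_coframeE opprK. Qed.

Lemma lie_flag4 X Y : lie X Y \in <<drop 4 e>>%VS.
Proof.
apply/(mem_flagP be) => i i4 _; rewrite xi_lieE d1234 ?oppr0 //.
by case: i i4 => [|[|[|[|[|i]]]]].
Qed.

(** The fifth and sixth coordinates of a bracket see only e^1, ..., e^4, which
    vanish on the vectors of <e_5, ..., e_8>. *)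
Lemma lie_flag6 X Y : X \in <<drop 4 e>>%VS -> lie X Y \in <<drop 6 e>>%VS.
Proof.
move=> /(mem_flagP be) X0; apply/(mem_flagP be) => i /andP[i0 i6] i8.
have [i4|] := leqP i 4.
  by have /(mem_flagP be) := lie_flag4 X Y; apply=> //; rewrite i0.
case: i i0 i6 i8 => [|[|[|[|[|[|[|i]]]]]]] // _ _ _ _;
  by rewrite xi_lieE d56 // asdE !X0 //; ring.
Qed.

Lemma xi_lie78 i X Y : i \in [:: 7; 8]%N -> xi e i (lie X Y) =
  - (c12 i * ((xi e 1 X * xi e 2 Y - xi e 1 Y * xi e 2 X)
       - (xi e 3 X * xi e 4 Y - xi e 3 Y * xi e 4 X))
   + (c12 i + c34 i) * ((xi e 3 X * xi e 4 Y - xi e 3 Y * xi e 4 X)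
       - (xi e 5 X * xi e 6 Y - xi e 5 Y * xi e 6 X))
   + c13 i * ((xi e 1 X * xi e 3 Y - xi e 1 Y * xi e 3 X)
       + (xi e 2 X * xi e 4 Y - xi e 2 Y * xi e 4 X))
   + c14 i * ((xi e 1 X * xi e 4 Y - xi e 1 Y * xi e 4 X)
       - (xi e 2 X * xi e 3 Y - xi e 2 Y * xi e 3 X))
   + c15 i * ((xi e 1 X * xi e 5 Y - xi e 1 Y * xi e 5 X)
       + (xi e 2 X * xi e 6 Y - xi e 2 Y * xi e 6 X))
   + c16 i * ((xi e 1 X * xi e 6 Y - xi e 1 Y * xi e 6 X)
       - (xi e 2 X * xi e 5 Y - xi e 2 Y * xi e 5 X))
   + c35 i * ((xi e 3 X * xi e 5 Y - xi e 3 Y * xi e 5 X)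
       + (xi e 4 X * xi e 6 Y - xi e 4 Y * xi e 6 X))
   + c36 i * ((xi e 3 X * xi e 6 Y - xi e 3 Y * xi e 6 X)
       - (xi e 4 X * xi e 5 Y - xi e 4 Y * xi e 5 X))).
Proof. by move=> i78; rewrite xi_lieE d78 // -!coframe2E. Qed.

Lemma flag6_sub_center : (<<drop 6 e>> <= center g)%VS.
Proof.
apply/subvP => X /(mem_flagP be) X0; apply/centerP => Y.
apply: (xi_eq0 be) => i /andP[i0 i8].
have [i6|] := leqP i 6.
  have /(mem_flagP be) : lie X Y \in <<drop 6 e>>%VS; last by apply=> //; rewrite i0.
  by apply: lie_flag6; apply/(mem_flagP be) => j /andP[j0 j4] j8;
     rewrite X0 // j0 (leq_trans j4).
case: i i0 i8 => [|[|[|[|[|[|[|[|[|i]]]]]]]]] // _ _ _;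
  by rewrite xi_lie78 // !X0 //; ring.
Qed.

Lemma centerE : center g = <<drop 6 e>>%VS.
Proof.
by apply/eqP; rewrite eq_sym eqEdim flag6_sub_center dimZ (dim_flag be).
Qed.

Lemma center_xi X i : X \in center g -> (0 < i <= 6)%N -> xi e i X = 0.
Proof.
rewrite centerE => /(mem_flagP be) X0 i6; apply: X0 => //.
by case/andP: i6 => _ /leq_trans; apply.
Qed.

Lemma lower_central3 : lower_central g 3 = 0%VS.
Proof.
apply: lower_centralS_eq0; rewrite centerE.
apply: lie_prodv_sub => X Y X1 _; apply: lie_flag6.
by apply: subvP X1; apply: lower_central1_sub; apply: lie_flag4.
Qed.

Lemma lower_central1_neq0 : lower_central g 1 <> 0%VS.
Proof.
move=> L1; have : (fullv <= center g)%VS.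
  apply/subvP => X _; apply/centerP => Y; apply/eqP; rewrite -memv0 -L1.
  by rewrite memv_lie ?memvf.
move=> /dimvS; rewrite dimZ.
by have /eqP := basis_free be; rewrite (span_basis be) size_tuple => ->.
Qed.

Lemma lower_central2_eq0P :
  lower_central g 2 = 0%VS <->
  ce_diff (coframe e 5) = 0 /\ ce_diff (coframe e 6) = 0.
Proof.
split=> [L2|[d5 d6]].
  have Z X Y : lie X Y \in center g.
    apply/centerP => W; apply/eqP; rewrite -memv0 -L2.
    by rewrite !memv_lie ?memvf.
  by split; apply: form2P => X Y; rewrite ce_diff_coframeE center_xi ?oppr0.
apply: lower_centralS_eq0; apply: lower_central1_sub => X Y.
rewrite centerE; apply/(mem_flagP be) => i /andP[i0 i6] i8.
have [i4|] := leqP i 4.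
  by have /(mem_flagP be) := lie_flag4 X Y; apply=> //; rewrite i0.
by case: i i0 i6 i8 => [|[|[|[|[|[|[|i]]]]]]] // _ _ _ _;
   rewrite xi_lieE ?d5 ?d6 oppr0.
Qed.

(** A relation between de^5 and de^6 confines [g, g] to a line <u> modulo the
    center, with C as its coefficient. If C were nonzero, the Jacobi identity
    would make u central, although u is outside the center <e_7, e_8>. *)
Lemma dependent_ce_diff_eq0 a b :
  a *: ce_diff (coframe e 5) + b *: ce_diff (coframe e 6) = 0 ->
  ~ (a = 0 /\ b = 0) ->
  ce_diff (coframe e 5) = 0 /\ ce_diff (coframe e 6) = 0.
Proof.
move=> ab0 abN0.
have N0 : a ^+ 2 + b ^+ 2 != 0.
  apply/eqP => /eqP; rewrite !paddr_eq0 ?sqr_ge0 // !sqrf_eq0.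
  by move=> /andP[/eqP ? /eqP ?]; apply: abN0.
(* u spans the direction orthogonal to a e_5 + b e_6 in <e_5, e_6>, in which the
   brackets lie, modulo the center, by the relation; C is a de^6 - b de^5. *)
pose u := a *: e`_5 - b *: e`_4.
pose k (c : nat -> R) := a * c 6%N - b * c 5%N.
pose C := asd e (k c12) (k c13) (k c14).
have dep X Y : a * xi e 5 (lie X Y) + b * xi e 6 (lie X Y) = 0.
  have /(congr1 (fun f => f (ffun_pair X Y))) := ab0.
  rewrite !(fctE, scalrfctE) /= !ce_diff_coframeE /GRing.scale /=.
  by move=> /eqP; rewrite !mulrN -opprD oppr_eq0 => /eqP.
have CE X Y : C (ffun_pair X Y) = - (a * xi e 6 (lie X Y) - b * xi e 5 (lie X Y)).
  by rewrite /C !xi_lieE !d56 // !asdE /k; ring.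
have lieE X Y : (a ^+ 2 + b ^+ 2) *: lie X Y + C (ffun_pair X Y) *: u \in center g.
  rewrite centerE; apply/(mem_flagP be) => i /andP[i0 i6] i8.
  rewrite linearP /= /u linearZ linearB /= !linearZ /= !xi_basis ?i0 //.
  have [i4|] := leqP i 4.
    have /(mem_flagP be)-> // := lie_flag4 X Y; last by rewrite i0.
    by case: i i0 i4 {i6 i8} => [|[|[|[|[|i]]]]] //= _ _; ring.
  rewrite CE; have D := dep X Y.
  case: i i0 i6 i8 => [|[|[|[|[|[|[|i]]]]]]] //= _ _ _ _.
    transitivity (a * (a * xi e 5 (lie X Y) + b * xi e 6 (lie X Y))); first ring.
    by rewrite D mulr0.
  transitivity (b * (a * xi e 5 (lie X Y) + b * xi e 6 (lie X Y))); first ring.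
  by rewrite D mulr0.
have lieuE X Y Z : C (ffun_pair X Y) *: lie Z u
                   = - (a ^+ 2 + b ^+ 2) *: lie Z (lie X Y).
  have /centerP/(_ Z) := lieE X Y; rewrite lie_anticomm linearDr !linearZr_LR /=.
  by move/eqP; rewrite oppr_eq0 addrC addr_eq0 scaleNr => /eqP.
have [k0|kN0] := pselect (k c12 = 0 /\ k c13 = 0 /\ k c14 = 0).
  have C0 X Y : a * xi e 6 (lie X Y) - b * xi e 5 (lie X Y) = 0.
    apply/eqP; rewrite -oppr_eq0 -CE /C asdE.
    by have [-> [-> ->]] := k0; apply/eqP; ring.
  have xi5 X Y : xi e 5 (lie X Y) = 0.
    apply: (mulfI N0); rewrite mulr0.
    transitivity (a * (a * xi e 5 (lie X Y) + b * xi e 6 (lie X Y))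
                  - b * (a * xi e 6 (lie X Y) - b * xi e 5 (lie X Y))); first ring.
    by rewrite dep C0; ring.
  have xi6 X Y : xi e 6 (lie X Y) = 0.
    apply: (mulfI N0); rewrite mulr0.
    transitivity (b * (a * xi e 5 (lie X Y) + b * xi e 6 (lie X Y))
                  + a * (a * xi e 6 (lie X Y) - b * xi e 5 (lie X Y))); first ring.
    by rewrite dep C0; ring.
  by split; apply: form2P => X Y; rewrite ce_diff_coframeE ?xi5 ?xi6 oppr0.
have uZ : u \in center g.
  apply/centerP => X; rewrite lie_anticomm; apply/eqP; rewrite oppr_eq0; apply/eqP.
  apply: (xi_eq0 be) => j _.
  apply: (asd_wedge_inj be (f := fun X => xi e j (lie X u)) kN0) => {}X Y Z.
  have jac : C (ffun_pair X Y) *: lie Z u + C (ffun_pair Y Z) *: lie X u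
             + C (ffun_pair Z X) *: lie Y u = 0.
    by rewrite !lieuE -!scalerDr lie_jacobi scaler0.
  by clearbody u; have /(congr1 (xi e j)) := jac; rewrite !linearD !linearZ linear0.
case: abN0; split.
  by rewrite -(center_xi (i := 6) uZ) // /u linearB !linearZ /= !xi_basis //=; ring.
apply/eqP; rewrite -oppr_eq0 -(center_xi (i := 5) uZ) //.
by rewrite /u linearB !linearZ /= !xi_basis //=; apply/eqP; ring.
Qed.

End StructureEquations.

Theorem proposition4p11 (R : realType) (g : lieAlgType R)
    (J : 'End(g)) (h : {dot g for idfun}) (e : 8.-tuple g)
    (c12 c13 c14 c34 c15 c16 c35 c36 : nat -> R) :
  \dim {:g} = 8%N ->
  nilpotent g ->
  \dim (center g) = 2%N ->
  abelian_balanced J h ->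
  adapted_basis J h e ->
  (forall i, i \in [:: 1; 2; 3; 4]%N -> ce_diff (coframe e i) = 0) ->
  (forall i, i \in [:: 5; 6]%N ->
    ce_diff (coframe e i) =
      c12 i *: beta1 e + c13 i *: gamma13 e + c14 i *: gamma14 e) ->
  (forall i, i \in [:: 7; 8]%N ->
    ce_diff (coframe e i) =
      c12 i *: beta1 e + (c12 i + c34 i) *: beta2 e
      + c13 i *: gamma13 e + c14 i *: gamma14 e
      + c15 i *: gamma15 e + c16 i *: gamma16 e
      + c35 i *: gamma25 e + c36 i *: gamma26 e) ->
  ((ce_diff (coframe e 5) = 0 /\ ce_diff (coframe e 6) = 0)
     /\ step_nilpotent g 2)
  \/ (lin_indep2 (ce_diff (coframe e 5)) (ce_diff (coframe e 6))
     /\ step_nilpotent g 3).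
Proof.
move=> _ _ dimZ _ [be _ _] d1234 d56 d78.
have L2P := lower_central2_eq0P be dimZ d1234 d56 d78.
have [/L2P L2|d56N0] :=
  pselect (ce_diff (coframe e 5) = 0 /\ ce_diff (coframe e 6) = 0).
  left; split; first exact/L2P.
  exact: step_nilpotentS L2 (lower_central1_neq0 be dimZ).
right; split=> [a b ab0|]; last first.
  apply: step_nilpotentS; first exact: lower_central3 be dimZ d1234 d56 d78.
  by move=> /L2P.
apply: contrapT => abN0; apply: d56N0.
exact (dependent_ce_diff_eq0 be dimZ d1234 d56 d78 ab0 abN0).
Qed.
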